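(* For all formulas $\alpha_1,\alpha_2$: if $\vDash_{\mathbf{SU}}\alpha_1\lor\alpha_2$, then $\vDash_{\mathbf{SU}}\alpha_1$ or $\vDash_{\mathbf{SU}}\alpha_2$.
   Context: Formulas are built from countably many propositional variables and $\bot$ with $\land,\lor,\to$; $\neg\alpha$ abbreviates $\alpha\to\bot$. For an $\mathbf{S4}$ frame $\langle W,R\rangle$ ($R$ reflexive and transitive) and $X\subseteq W$ put $\mathord{\uparrow}X=\{w:\exists x\in X,\ xRw\}$, $\Diamond X=\{w:\exists x\in X,\ wRx\}$, $\Box X=\{w:\forall v(wRv\Rightarrow v\in X)\}$. A point $z$ strongly unites $x_0,x_1$ if $zRx_0$, $zRx_1$, $z\in\Box(\mathord{\uparrow}\{x_0\}\cup\Diamond\mathord{\uparrow}\{x_1\})$ and $z\in\Box(\mathord{\uparrow}\{x_1\}\cup\Diamond\mathord{\uparrow}\{x_0\})$. The frame satisfies $(su_2)$ if for every $w$ and all $x_0,x_1$ with $wRx_0$, $wRx_1$ there is $z$ with $wRz$ strongly uniting $x_0,x_1$. $\vDash_{\mathbf{SU}}\phi$ means $\phi$ is true at every point under every upward-closed valuation (intuitionistic Kripke semantics) in every $\mathbf{S4}$ frame satisfying $(su_2)$. *)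

(* Defs.v *)
From Stdlib Require Export Relations Ensembles.

Inductive formula : Type :=
| Var (n : nat)
| Bot
| And (a b : formula)
| Or (a b : formula)
| Imp (a b : formula).

Definition s4_frame (W : Type) (R : relation W) : Prop :=
  reflexive W R /\ transitive W R.

Definition up (W : Type) (R : relation W) (X : Ensemble W) : Ensemble W :=
  fun w => exists x, In W X x /\ R x w.

Definition dia (W : Type) (R : relation W) (X : Ensemble W) : Ensemble W :=
  fun w => exists x, In W X x /\ R w x.

Definition box (W : Type) (R : relation W) (X : Ensemble W) : Ensemble W :=
  fun w => forall v, R w v -> In W X v.

Definition strongly_unites (W : Type) (R : relation W) (z x0 x1 : W) : Prop :=
  R z x0 /\ R z x1 /\
  In W (box W R (Union W (up W R (Singleton W x0))
                         (dia W R (up W R (Singleton W x1))))) z /\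
  In W (box W R (Union W (up W R (Singleton W x1))
                         (dia W R (up W R (Singleton W x0))))) z.

Definition su2 (W : Type) (R : relation W) : Prop :=
  forall w x0 x1 : W, R w x0 -> R w x1 ->
    exists z, R w z /\ strongly_unites W R z x0 x1.

Definition upward_closed (W : Type) (R : relation W) (X : Ensemble W) : Prop :=
  forall w v : W, In W X w -> R w v -> In W X v.

Fixpoint forces (W : Type) (R : relation W) (V : nat -> Ensemble W)
    (w : W) (phi : formula) : Prop :=
  match phi with
  | Var n => In W (V n) w
  | Bot => False
  | And a b => forces W R V w a /\ forces W R V w b
  | Or a b => forces W R V w a \/ forces W R V w b
  | Imp a b => forall v, R w v -> forces W R V v a -> forces W R V v b
  end.

Definition SU_valid (phi : formula) : Prop :=
  forall (W : Type) (R : relation W), s4_frame W R -> su2 W R ->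
  forall V : nat -> Ensemble W, (forall n, upward_closed W R (V n)) ->
  forall w : W, forces W R V w phi.

(* Main.v *)
(** Countermodels [M1] of [alpha1] and [M2] of [alpha2] are glued into one frame:
    the product of [M1] and [M2], each with a new top element adjoined, minus the
    pair of the two tops. The points whose second (first) coordinate is the top
    form an up-set isomorphic to [M1] ([M2]), so the pair of the refuting points
    refutes both disjuncts. [su2] is inherited coordinatewise: to see that two
    points are compatible it suffices to join them in one coordinate and move to
    the top in the other. *)
From Stdlib Require Import Classical.
Require Import Defs.

(* [Fst a] and [Snd b] are the pairs (a, top) and (top, b). *)
Inductive glue (W1 W2 : Type) : Type :=
| Fst (a : W1)
| Snd (b : W2)
| Both (a : W1) (b : W2).
Arguments Fst {W1 W2} a.
Arguments Snd {W1 W2} b.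
Arguments Both {W1 W2} a b.

(** The componentwise order: an adjoined top sees only itself, hence [False] wherever a top would
    have to see a proper entry. *)
Definition glue_rel {W1 W2 : Type} (R1 : relation W1) (R2 : relation W2) :
    relation (glue W1 W2) :=
  fun p q =>
    match p, q with
    | Fst a, Fst a' => R1 a a'
    | Snd b, Snd b' => R2 b b'
    | Both a b, Fst a' => R1 a a'
    | Both a b, Snd b' => R2 b b'
    | Both a b, Both a' b' => R1 a a' /\ R2 b b'
    | _, _ => False
    end.

(** Every variable holds at the adjoined tops, so a top coordinate imposes no condition. *)
Definition glue_val {W1 W2 : Type} (V1 : nat -> Ensemble W1)
    (V2 : nat -> Ensemble W2) : nat -> Ensemble (glue W1 W2) :=
  fun n p =>
    match p with
    | Fst a => V1 n a
    | Snd b => V2 n b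
    | Both a b => V1 n a /\ V2 n b
    end.

(** Going up from a singleton is going up from its element, so each [box] clause says that [v] is
    above one point or has a common upper bound with the other. *)
Lemma strongly_unites_iff (W : Type) (R : relation W) (z x0 x1 : W) :
  strongly_unites W R z x0 x1 <->
  R z x0 /\ R z x1 /\
  (forall v, R z v -> R x0 v \/ exists u, R x1 u /\ R v u) /\
  (forall v, R z v -> R x1 v \/ exists u, R x0 u /\ R v u).
Proof.
  assert (box_iff : forall x y,
    In W (box W R (Union W (up W R (Singleton W x))
                           (dia W R (up W R (Singleton W y))))) z <->
    (forall v, R z v -> R x v \/ exists u, R y u /\ R v u)).
  { intros x y; split; intros H v zv.
    - destruct (H v zv) as [v' [t [tx tv]] | v' [u [[t [ty tu]] vu]]].
      + destruct tx; now left.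
      + destruct ty; right; now exists u.
    - destruct (H v zv) as [xv | [u [yu vu]]].
      + left; exists x; split; [constructor | exact xv].
      + right; exists u; split; [exists y; split; [constructor |] |]; assumption. }
  unfold strongly_unites; rewrite !box_iff; reflexivity.
Qed.

Lemma glue_s4 (W1 W2 : Type) (R1 : relation W1) (R2 : relation W2) :
  s4_frame W1 R1 -> s4_frame W2 R2 -> s4_frame (glue W1 W2) (glue_rel R1 R2).
Proof.
  intros [refl1 tr1] [refl2 tr2]; split.
  - intros [a | b | a b]; simpl; auto.
  - intros [a | b | a b] [a' | b' | a' b'] [a'' | b'' | a'' b'']; simpl;
      intuition; eauto.
Qed.

Ltac settle :=
  simpl in *; repeat match goal with
  | H : _ /\ _ |- _ => destruct H
  | H : False |- _ => destruct H
  end.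

(** Candidates for the common upper bound [u]: the point [v] itself if it has a top coordinate, [v]
    with one coordinate moved to the top, or a bound known in one coordinate paired with the top. *)
Ltac compatible :=
  solve [ left; simpl; auto
        | right; match goal with
          | |- exists u, glue_rel _ _ _ u /\ glue_rel _ _ (Fst ?a) u =>
              exists (Fst a); simpl; auto
          | |- exists u, glue_rel _ _ _ u /\ glue_rel _ _ (Snd ?b) u =>
              exists (Snd b); simpl; auto
          | |- exists u, glue_rel _ _ _ u /\ glue_rel _ _ (Both ?a ?b) u =>
              solve [exists (Fst a); simpl; auto | exists (Snd b); simpl; auto]
          end
        | match goal with u : _ |- _ =>
            right; solve [exists (Fst u); simpl; auto | exists (Snd u); simpl; auto]
          end ].

(* A point [v] above the chosen [z] is classified by each coordinate that [z] unites. *)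
Ltac verify :=
  simpl; repeat split; auto;
  intros [? | ? | ? ?] ?; settle; try compatible;
  repeat match goal with
  | H : forall v, ?R ?z v -> _, H' : ?R ?z ?v |- _ =>
      let K := fresh in
      pose proof (H v H') as K; clear H; destruct K as [? | [? [? ?]]]
  end; compatible.

Lemma glue_su2 (W1 W2 : Type) (R1 : relation W1) (R2 : relation W2) :
  s4_frame W1 R1 -> s4_frame W2 R2 -> su2 W1 R1 -> su2 W2 R2 ->
  su2 (glue W1 W2) (glue_rel R1 R2).
Proof.
  intros [refl1 tr1] [refl2 tr2] su1 su2' w x0 x1 wx0 wx1.
  assert (unite1 : forall c a0 a1, R1 c a0 -> R1 c a1 -> exists z, R1 c z /\
    R1 z a0 /\ R1 z a1 /\
    (forall v, R1 z v -> R1 a0 v \/ exists u, R1 a1 u /\ R1 v u) /\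
    (forall v, R1 z v -> R1 a1 v \/ exists u, R1 a0 u /\ R1 v u)).
  { intros c a0 a1 h0 h1; destruct (su1 c a0 a1 h0 h1) as [z [cz hz]].
    exists z; split; [exact cz | now apply strongly_unites_iff]. }
  assert (unite2 : forall d b0 b1, R2 d b0 -> R2 d b1 -> exists z, R2 d z /\
    R2 z b0 /\ R2 z b1 /\
    (forall v, R2 z v -> R2 b0 v \/ exists u, R2 b1 u /\ R2 v u) /\
    (forall v, R2 z v -> R2 b1 v \/ exists u, R2 b0 u /\ R2 v u)).
  { intros d b0 b1 h0 h1; destruct (su2' d b0 b1 h0 h1) as [z [dz hz]].
    exists z; split; [exact dz | now apply strongly_unites_iff]. }
  clear su1 su2'.
  enough (exists z, glue_rel R1 R2 w z /\
    glue_rel R1 R2 z x0 /\ glue_rel R1 R2 z x1 /\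
    (forall v, glue_rel R1 R2 z v ->
      glue_rel R1 R2 x0 v \/ exists u, glue_rel R1 R2 x1 u /\ glue_rel R1 R2 v u) /\
    (forall v, glue_rel R1 R2 z v ->
      glue_rel R1 R2 x1 v \/ exists u, glue_rel R1 R2 x0 u /\ glue_rel R1 R2 v u))
    as [z [wz hz]].
  { exists z; split; [exact wz | now apply strongly_unites_iff]. }
  destruct x0 as [a0 | b0 | a0 b0], x1 as [a1 | b1 | a1 b1];
    destruct w as [c | d | c d]; settle;
    (* A uniting point is taken in a coordinate only where both [x0] and [x1] have proper
       entries. *)
    try (destruct (unite1 c a0 a1) as [z1 [? [? [? [? ?]]]]]; [assumption .. |]);
    try (destruct (unite2 d b0 b1) as [z2 [? [? [? [? ?]]]]]; [assumption .. |]);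
    clear unite1 unite2.
  (* In each coordinate [z] has the uniting point of two proper entries, the only proper entry if
     the other is the top, and the top if both are. In the last case a proper entry would fail: [z]
     would see a [Snd] point, which has no common upper bound with a [Fst] point, or vice versa. *)
  - exists (Fst z1); verify.
  - exists (Fst z1); verify.
  - exists (Both a0 b1); verify.
  - exists (Both z1 b1); verify.
  - exists (Both a1 b0); verify.
  - exists (Snd z2); verify.
  - exists (Snd z2); verify.
  - exists (Both a1 z2); verify.
  - exists (Both z1 b0); verify.
  - exists (Both a0 z2); verify.
  - exists (Both z1 z2); verify.
Qed.

Lemma glue_val_up (W1 W2 : Type) (R1 : relation W1) (R2 : relation W2)
    (V1 : nat -> Ensemble W1) (V2 : nat -> Ensemble W2) (n : nat) :
  upward_closed W1 R1 (V1 n) -> upward_closed W2 R2 (V2 n) ->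
  upward_closed (glue W1 W2) (glue_rel R1 R2) (glue_val V1 V2 n).
Proof.
  unfold upward_closed, In.
  intros up1 up2 [a | b | a b] [a' | b' | a' b']; simpl; intuition; eauto.
Qed.

Lemma forces_up (W : Type) (R : relation W) (V : nat -> Ensemble W)
    (phi : formula) (w v : W) :
  transitive W R -> (forall n, upward_closed W R (V n)) ->
  R w v -> forces W R V w phi -> forces W R V v phi.
Proof.
  intros tr upV wv.
  induction phi as [n | | a IHa b IHb | a IHa b IHb | a _ b _]; simpl.
  - intros H; exact (upV n w v H wv).
  - easy.
  - tauto.
  - tauto.
  - intros H u vu; exact (H u (tr _ _ _ wv vu)).
Qed.

(** Forcing at a point depends only on the points above it. Since the image of [f] is an up-set,
    implication at [f w] quantifies over image points only. *)
Lemma forces_upset_embedding (W W' : Type) (R : relation W) (R' : relation W')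
    (V : nat -> Ensemble W) (V' : nat -> Ensemble W') (f : W -> W') :
  (forall w v, R' (f w) (f v) <-> R w v) ->
  (forall w v', R' (f w) v' -> exists v, v' = f v) ->
  (forall n w, V' n (f w) <-> V n w) ->
  forall phi w, forces W' R' V' (f w) phi <-> forces W R V w phi.
Proof.
  intros fR fup fV.
  induction phi as [n | | a IHa b IHb | a IHa b IHb | a IHa b IHb];
    intros w; simpl.
  - apply fV.
  - reflexivity.
  - now rewrite IHa, IHb.
  - now rewrite IHa, IHb.
  - split; intros H v wv Ha.
    + apply IHb, H; [now apply fR | now apply IHa].
    + destruct (fup w v wv) as [u ->].
      apply IHb, H; [now apply fR | now apply IHa].
Qed.

Lemma forces_Fst (W1 W2 : Type) (R1 : relation W1) (R2 : relation W2)
    (V1 : nat -> Ensemble W1) (V2 : nat -> Ensemble W2) (phi : formula) (a : W1) :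
  forces (glue W1 W2) (glue_rel R1 R2) (glue_val V1 V2) (Fst a) phi <->
  forces W1 R1 V1 a phi.
Proof.
  apply (forces_upset_embedding W1 (glue W1 W2) R1 (glue_rel R1 R2) V1
           (glue_val V1 V2) Fst); try reflexivity.
  intros w [a' | b' | a' b']; simpl; [eauto | easy | easy].
Qed.

Lemma forces_Snd (W1 W2 : Type) (R1 : relation W1) (R2 : relation W2)
    (V1 : nat -> Ensemble W1) (V2 : nat -> Ensemble W2) (phi : formula) (b : W2) :
  forces (glue W1 W2) (glue_rel R1 R2) (glue_val V1 V2) (Snd b) phi <->
  forces W2 R2 V2 b phi.
Proof.
  apply (forces_upset_embedding W2 (glue W1 W2) R2 (glue_rel R1 R2) V2
           (glue_val V1 V2) Snd); try reflexivity.
  intros w [a' | b' | a' b']; simpl; [easy | eauto | easy].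
Qed.

Theorem theorem4 (alpha1 alpha2 : formula) :
  SU_valid (Or alpha1 alpha2) -> SU_valid alpha1 \/ SU_valid alpha2.
Proof.
  intros valid.
  destruct (classic (SU_valid alpha1)) as [valid1 | invalid1]; [now left | right].
  intros W2 R2 S4_2 su_2 V2 up2 w2.
  (* No countermodel of [alpha1] is extracted: given a refutation of [alpha2] at [w2], every point
     [w1] of every model is shown to force [alpha1]. *)
  apply NNPP; intros refuted2; apply invalid1.
  intros W1 R1 S4_1 su_1 V1 up1 w1.
  pose proof (glue_s4 W1 W2 R1 R2 S4_1 S4_2) as S4.
  assert (upV : forall n, upward_closed _ (glue_rel R1 R2) (glue_val V1 V2 n))
    by (intros n; now apply glue_val_up).
  destruct (valid _ _ S4 (glue_su2 W1 W2 R1 R2 S4_1 S4_2 su_1 su_2)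
              (glue_val V1 V2) upV (Both w1 w2)) as [H | H].
  (* Persistence carries the forced disjunct from [Both w1 w2] to the copy [Fst w1] of [w1] or, in
     the other case, to the copy [Snd w2] of [w2], against [refuted2]. *)
  - apply (forces_Fst W1 W2 R1 R2 V1 V2).
    apply (forces_up _ (glue_rel R1 R2) _ _ (Both w1 w2)); auto.
    + apply S4.
    + apply S4_1.
  - destruct refuted2; apply (forces_Snd W1 W2 R1 R2 V1 V2).
    apply (forces_up _ (glue_rel R1 R2) _ _ (Both w1 w2)); auto.
    + apply S4.
    + apply S4_2.
Qed.
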